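(* Let $m,n\ge 2$ be integers, let $f$ be an $m$-nomial in $n$ variables such that $\dim \mathrm{Newt}(f) = n$, and let $Z := f^{-1}(0)\subset\mathbb{R}_+^n$. Then $$\mathrm{Non}(Z)\le 2n\,P(n-1,m-1)$$ and $$\mathrm{Tot}(Z)\le \sum_{i=0}^{n-1} 2^i\,\frac{n!}{(n-i)!}\,P_{comp}(n-i,m-i).$$
   Context: $\mathbb{N}$ denotes the positive integers, and $\mathbb{R}_+^n = \{(x_1,\dots,x_n)\in\mathbb{R}^n : x_k>0 \text{ for } 1\le k\le n\}$. For $x\in\mathbb{R}_+^n$ and $a=(a_1,\dots,a_n)\in\mathbb{R}^n$, $x^a := x_1^{a_1}\cdots x_n^{a_n}$. For $m \in \mathbb{N}$, an $m$-nomial in $n$ variables is a function $f:\mathbb{R}_+^n\to\mathbb{R}$ of the form $f(x)=\sum_{i=1}^m c_i x^{a_i}$ with $c_i\in\mathbb{R}$, $c_i\neq 0$, and pairwise distinct exponent vectors $a_i\in\mathbb{R}^n$. The Newton polytope $\mathrm{Newt}(f)$ is the convex hull of $\{a_1,\dots,a_m\}$, and $\dim\mathrm{Newt}(f)$ is the dimension of its affine span. For $X\subset\mathbb{R}_+^n$, $\mathrm{Tot}(X)$, $\mathrm{Comp}(X)$ and $\mathrm{Non}(X)$ are the numbers of connected components, compact connected components and non-compact connected components of $X$, respectively (a bounded component may be non-compact, since $\mathbb{R}_+^n$ is not closed). Let $\Omega(n,m)$ be the set of all $k$-nomials in $n$ variables with $1\le k\le m$; define $P(n,m) := \max\{\mathrm{Tot}(f^{-1}(0))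 : f\in\Omega(n,m)\}$ and $P_{comp}(n,m) := \max\{\mathrm{Comp}(f^{-1}(0)) : f\in\Omega(n,m)\}$ (these maxima are known to be finite). *)

(* Defs.v *)
From HB Require Import structures.
From mathcomp Require Import all_boot all_order all_algebra.
From mathcomp Require Import all_classical all_reals all_analysis.
Set Implicit Arguments.
Unset Strict Implicit.
Unset Printing Implicit Defensive.
Import Order.TTheory GRing.Theory Num.Theory.
Import numFieldNormedType.Exports.

Local Open Scope classical_set_scope.
Local Open Scope ring_scope.

Definition pos_orthant (R : realType) (n : nat) : set 'rV[R]_n :=
  [set x | forall k, 0 < x 0 k].
Arguments pos_orthant : clear implicits.

Definition monomial (R : realType) (n : nat) (x a : 'rV[R]_n) : R :=
  \prod_(k < n) x 0 k `^ a 0 k.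

(* A function on the orthant is represented by a function on the whole space
   whose values outside the orthant are irrelevant. *)
Definition is_nomial (R : realType) (n m : nat)
    (c : 'I_m -> R) (a : 'I_m -> 'rV[R]_n) (f : 'rV[R]_n -> R) : Prop :=
  [/\ forall i, c i != 0,
      injective a &
      forall x, pos_orthant R n x -> f x = \sum_(i < m) c i * monomial x (a i)].

Definition Omega (R : realType) (n m : nat) : set ('rV[R]_n -> R) :=
  [set f | exists k (c : 'I_k -> R) (a : 'I_k -> 'rV[R]_n),
             (1 <= k <= m)%N /\ is_nomial c a f].
Arguments Omega : clear implicits.

Definition zero_set (R : realType) (n : nat) (f : 'rV[R]_n -> R) :
    set 'rV[R]_n :=
  [set x | pos_orthant R n x /\ f x = 0].

Definition Newt (R : realType) (n m : nat) (a : 'I_m -> 'rV[R]_n) :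
    set 'rV[R]_n :=
  smallest (fun A => convex_set A) (range a).

(* The affine subspace x + U. *)
Definition translate (R : realType) (n : nat)
    (x : 'rV[R]_n) (U : {vspace 'rV[R]_n}) : set 'rV[R]_n :=
  [set x + u | u in [set u | u \in U]].

Definition affine_span (R : realType) (n : nat) (S : set 'rV[R]_n) :
    set 'rV[R]_n :=
  smallest [set A | exists x U, A = translate x U] S.

Definition has_dim (R : realType) (n : nat) (S : set 'rV[R]_n) (d : nat) :=
  exists x U, affine_span S = translate x U /\ \dim U = d.

Definition components (T : topologicalType) (X : set T) : set (set T) :=
  [set connected_component X x | x in X].

(* [counting] is the cardinality of a finite set and +oo on infinite sets. *)
Definition Tot (R : realType) (n : nat) (X : set 'rV[R]_n) : \bar R :=
  counting (components X).

Definition Comp (R : realType) (n : nat) (X : set 'rV[R]_n) : \bar R :=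
  counting (components X `&` [set K | compact K]).

Definition Non (R : realType) (n : nat) (X : set 'rV[R]_n) : \bar R :=
  counting (components X `&` [set K | ~ compact K]).

(* The maxima over Omega are taken as suprema in \bar R. A finite supremum of
   natural numbers is attained, so these are the maxima, with no need to build
   their finiteness into the definition. *)
Definition P (R : realType) (n m : nat) : \bar R :=
  ereal_sup [set Tot (zero_set f) | f in Omega R n m].

Definition P_comp (R : realType) (n m : nat) : \bar R :=
  ereal_sup [set Comp (zero_set f) | f in Omega R n m].
Arguments P : clear implicits.
Arguments P_comp : clear implicits.

(* Main.v *)
(* In logarithmic coordinates Z becomes the zero set W of an exponential sum
   sum_i c_i exp(<a_i, y>) on R^n, and since the exponents affinely span R^n a
   linear change of coordinates gives a_(s p) - a_(i0) = e_p for every p.  W is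
   closed, so a non-compact component is unbounded and, being connected, meets
   the boundary of every large cube.  On a facet y_p = +-T the terms i0 and s p
   merge, so the slice of W is the zero set of an exponential sum in n - 1
   variables with at most m - 1 terms; for T large none of its coefficients
   cancels.  Distinct components of W meeting a facet contain distinct components
   of the slice, and there are 2n facets: this is the first bound.

   The exponents of a slice, being a projection of the a_i, affinely span
   R^(n-1), so the second bound follows by induction on n among spanning exponent
   families only.  The induction starts at n = 0, where W is empty. *)
Require Import Defs.
From mathcomp Require Import all_boot all_order all_algebra finmap.
From mathcomp Require Import all_classical all_reals all_analysis.
Set Implicit Arguments.
Unset Strict Implicit.
Unset Printing Implicit Defensive.
Import Order.TTheory GRing.Theory Num.Theory.
Import numFieldNormedType.Exports.

Local Open Scope classical_set_scope.
Local Open Scope ring_scope.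

(** * Cardinalities of possibly infinite sets *)

Lemma counting_fset (R : realType) (T : choiceType) (D : {fset T}) :
  counting [set` D] = (#|` D|)%:R%:E :> \bar R.
Proof. by rewrite /counting asboolT// set_fsetK. Qed.

(** An infinite set has finite subsets of every size, which forces [B] to be [+oo]. Thus components
    can be counted through finite families, without knowing beforehand that there are finitely
    many. *)
Lemma counting_le_fset (R : realType) (T : choiceType) (A : set T) (B : \bar R) :
  (forall D : {fset T}, [set` D] `<=` A -> ((#|` D|)%:R%:E <= B)%E) ->
  (counting A <= B)%E.
Proof.
move=> h; rewrite /counting; case: ifPn => /asboolP Af.
  by apply: h; rewrite fset_setK.
suff -> : B = +oo%E by [].
apply/eqyP => x x0; have [D DA xD] := infinite_set_fset (Num.truncn x).+1 Af.
apply: le_trans (h _ DA); rewrite lee_fin; apply/ltW/(lt_le_trans (truncnS_gt _)).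
by rewrite ler_nat.
Qed.

Lemma counting_le_inj (R : realType) (T U : choiceType) (f : T -> U)
    (A : set T) (B : set U) :
  set_inj A f -> f @` A `<=` B -> (counting A <= counting B :> \bar R)%E.
Proof.
move=> injf fAB; apply: counting_le_fset => D DA.
rewrite /counting; case: ifPn => /asboolP Bf; last by rewrite leey.
rewrite lee_fin ler_nat.
have -> : #|` D| = #|` (f @` D)%fset|.
  by rewrite card_in_imfset// => x y xD yD; apply: injf; rewrite inE; apply: DA.
apply: fsubset_leq_card; apply/fsubsetP => _ /imfsetP[x /= xD ->].
by rewrite in_fset_set// inE; apply: fAB; exists x => //; exact: DA.
Qed.

Lemma card_fset_fibers (T : choiceType) (I : finType) (p : T -> I) (D : {fset T}) :
  #|` D| = (\sum_(i : I) #|` [fset x in D | p x == i]%fset|)%N.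
Proof.
under eq_bigr do rewrite card_fset_sum1 -big_fset_condE/= big_mkcond/=.
rewrite exchange_big/= card_fset_sum1; apply: eq_bigr => x _.
by rewrite -big_mkcond/= (big_pred1 (p x))// => i; rewrite eq_sym.
Qed.

Lemma counting_le_split (R : realType) (T : choiceType) (A X : set T) :
  (counting A <= counting (A `&` X) + counting (A `&` ~` X) :> \bar R)%E.
Proof.
apply: counting_le_fset => D DA.
rewrite (card_fset_fibers (fun x => x \in X)) big_bool/= natrD EFinD.
by apply: leeD; rewrite -counting_fset; apply: (@counting_le_inj _ _ _ id) => //;
  rewrite image_id => x /=; rewrite !inE/= => /andP[/DA Ax /eqP xX]; split => //;
  [exact/set_mem | move/mem_set; rewrite xX].
Qed.

(** * Invariance of component counts under homeomorphism *)

(** A homeomorphism between subsets, given by total functions whose values elsewhere are arbitrary;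
    this accommodates the logarithm, which is continuous on the orthant only. *)
Definition inverse_homeos (T U : topologicalType) (X : set T) (Y : set U)
    (g : T -> U) (h : U -> T) :=
  [/\ {within X, continuous g}, {within Y, continuous h}, set_fun X Y g,
      set_fun Y X h & {in X, cancel g h} /\ {in Y, cancel h g}].

Lemma inverse_homeosC (T U : topologicalType) (X : set T) (Y : set U) g h :
  inverse_homeos X Y g h -> inverse_homeos Y X h g.
Proof. by case=> ? ? ? ? [? ?]; split. Qed.

Lemma image_component_sub (T U : topologicalType) (X : set T) (Y : set U)
    (g : T -> U) x :
  {within X, continuous g} -> set_fun X Y g -> X x ->
  g @` connected_component X x `<=` connected_component Y (g x).
Proof.
move=> cg XY Xx; apply: connected_component_max.
- by exists x => //; exact: connected_component_refl.
- by move=> _ [y /connected_component_sub Xy <-]; exact: XY.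
- apply: connected_continuous_connected; first exact: component_connected.
  by apply: continuous_subspaceW cg; exact: connected_component_sub.
Qed.

Lemma homeo_component (T U : topologicalType) (X : set T) (Y : set U) g h x :
  inverse_homeos X Y g h -> X x ->
  g @` connected_component X x = connected_component Y (g x).
Proof.
move=> [cg ch gXY hYX [gK hK]] Xx; apply/seteqP; split.
  exact: image_component_sub.
move=> y cy; exists (h y); last by rewrite hK// inE; exact: connected_component_sub cy.
rewrite -[x]gK ?inE//; apply: (image_component_sub ch) => //; first exact: gXY.
Qed.

Lemma homeo_compact (T U : topologicalType) (X A : set T) (Y : set U) g h :
  inverse_homeos X Y g h -> A `<=` X -> compact (g @` A) <-> compact A.
Proof.
move=> [cg ch gXY hYX [gK hK]] AX; split; last first.
  by apply: continuous_compact; exact: continuous_subspaceW cg.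
move=> cgA; suff -> : A = h @` (g @` A).
  apply: continuous_compact => //; apply: continuous_subspaceW ch.
  by move=> _ [x /AX Xx <-]; exact: gXY.
rewrite image_comp; apply/seteqP; split => [x Ax|_ [x Ax <-]]/=.
  by exists x => //=; rewrite gK// inE; exact: AX.
by rewrite gK// inE; exact: AX.
Qed.

(** Taking images under [g] is injective on subsets of [X] and maps components to components. The
    properties [QX] and [QY] let one statement serve [Tot], [Comp] and [Non]. *)
Lemma counting_components_le (R : realType) (T U : topologicalType) (X : set T)
    (Y : set U) g h (QX : set (set T)) (QY : set (set U)) :
  inverse_homeos X Y g h ->
  (forall A, A `<=` X -> QX A -> QY (g @` A)) ->
  (counting (components X `&` QX) <= counting (components Y `&` QY) :> \bar R)%E.
Proof.
move=> gh QXY; have [_ _ gXY _ [gK _]] := gh.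
have sub A : (components X `&` QX) A -> A `<=` X.
  by move=> [[x _ <-] _]; exact: connected_component_sub.
apply: (@counting_le_inj _ _ _ (image^~ g)).
  move=> A B /set_mem/sub AX /set_mem/sub BX gAB.
  have gA C : C `<=` X -> C = h @` (g @` C).
    move=> CX; rewrite image_comp; apply/seteqP; split => [x Cx|_ [x Cx <-]]/=.
      by exists x => //=; rewrite gK// inE; exact: CX.
    by rewrite gK// inE; exact: CX.
  by rewrite (gA _ AX) (gA _ BX) gAB.
move=> _ [A XA <-]; split; last by apply: QXY; [exact: sub|case: XA].
case: XA => -[x Xx <-] _; exists (g x); first exact: gXY.
by rewrite (homeo_component gh).
Qed.

Lemma homeo_Tot (R : realType) n p (X : set 'rV[R]_n) (Y : set 'rV[R]_p) g h :
  inverse_homeos X Y g h -> (Tot X <= Tot Y)%E.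
Proof.
move=> gh; rewrite /Tot -[components X]setIT -[components Y]setIT.
exact: counting_components_le gh _.
Qed.

Lemma homeo_Comp (R : realType) n p (X : set 'rV[R]_n) (Y : set 'rV[R]_p) g h :
  inverse_homeos X Y g h -> (Comp X <= Comp Y)%E.
Proof.
move=> gh; apply: (counting_components_le _ gh) => A AX.
exact: (homeo_compact gh AX).2.
Qed.

Lemma homeo_Non (R : realType) n p (X : set 'rV[R]_n) (Y : set 'rV[R]_p) g h :
  inverse_homeos X Y g h -> (Non X <= Non Y)%E.
Proof.
move=> gh; apply: (counting_components_le _ gh) => A AX NA.
by move/(homeo_compact gh AX).
Qed.

Lemma Tot_le_split (R : realType) n (X : set 'rV[R]_n) :
  (Tot X <= Comp X + Non X)%E.
Proof. exact: counting_le_split. Qed.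

(** * Exponential sums and logarithmic coordinates *)

Lemma mx_continuous_at (R : realType) (T : topologicalType) m n
    (f : T -> 'M[R]_(m, n)) x :
  (forall i j, {for x, continuous (fun t => f t i j)}) -> {for x, continuous f}.
Proof.
move=> fc A [P fxP PA]; rewrite nbhs_simpl/=.
suff : \forall t \near x, forall ij : 'I_m * 'I_n, P ij.1 ij.2 (f t ij.1 ij.2).
  by apply: filterS => t Pt; apply: PA => i j; exact: (Pt (i, j)).
by apply: filter_forall => -[i j]/=; apply: fc; exact: fxP.
Qed.

Definition dot (R : realType) n (u v : 'rV[R]_n) : R := (u *m v^T) 0 0.

Lemma dotE (R : realType) n (u v : 'rV[R]_n) : dot u v = \sum_j u 0 j * v 0 j.
Proof. by rewrite /dot mxE; apply: eq_bigr => j _; rewrite mxE. Qed.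

Lemma dotDl (R : realType) n (u v w : 'rV[R]_n) : dot (u + v) w = dot u w + dot v w.
Proof. by rewrite /dot mulmxDl mxE. Qed.

Lemma dotBl (R : realType) n (u v w : 'rV[R]_n) : dot (u - v) w = dot u w - dot v w.
Proof. by rewrite /dot mulmxBl !mxE. Qed.

Lemma dot_continuous (R : realType) n (u : 'rV[R]_n) : continuous (dot u).
Proof.
rewrite (_ : dot u = fun v => \sum_j u 0 j * v 0 j); last first.
  by apply/funext => v; rewrite dotE.
apply: (@continuous_big _ _ +%R).
  by move=> /= x; exact: add_continuous.
move=> j _ v; apply: (@continuous_comp _ _ _ (fun v : 'rV_n => v 0 j) ( *%R (u 0 j))).
  exact: coord_continuous.
exact: mulrl_continuous.
Qed.

Definition expsum (R : realType) n k (c : 'I_k -> R) (a : 'I_k -> 'rV[R]_n)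
  (y : 'rV[R]_n) : R := \sum_i c i * expR (dot (a i) y).

Definition expsum_zeros (R : realType) n k (c : 'I_k -> R) (a : 'I_k -> 'rV[R]_n) :
  set 'rV[R]_n := [set y | expsum c a y = 0].

Lemma expsum_continuous (R : realType) n k (c : 'I_k -> R) (a : 'I_k -> 'rV[R]_n) :
  continuous (expsum c a).
Proof.
apply: (@continuous_big _ _ +%R).
  by move=> /= x; exact: add_continuous.
move=> j _ v; apply: (@continuous_comp _ _ _ (fun v => expR (dot (a j) v)) ( *%R (c j))).
  apply: continuous_comp; first exact: dot_continuous.
  exact: continuous_expR.
exact: mulrl_continuous.
Qed.

Lemma closed_expsum_zeros (R : realType) n k (c : 'I_k -> R) (a : 'I_k -> 'rV[R]_n) :
  closed (expsum_zeros c a).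
Proof.
apply: (@closed_comp _ _ (expsum c a) [set 0]); last exact: closed_eq.
by move=> y _; exact: expsum_continuous.
Qed.

Definition expv (R : realType) n (y : 'rV[R]_n) : 'rV[R]_n := \row_k expR (y 0 k).
Definition lnv (R : realType) n (x : 'rV[R]_n) : 'rV[R]_n := \row_k ln (x 0 k).

Lemma monomialE (R : realType) n (x a : 'rV[R]_n) :
  pos_orthant R n x -> monomial x a = expR (dot a (lnv x)).
Proof.
move=> x0; rewrite dotE expR_sum; apply: eq_bigr => k _.
by rewrite /powR gt_eqF// mxE.
Qed.

Lemma nomial_expsum (R : realType) n m (c : 'I_m -> R) (a : 'I_m -> 'rV[R]_n) f :
  is_nomial c a f ->
  inverse_homeos (zero_set f) (expsum_zeros c a) (@lnv R n) (@expv R n).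
Proof.
move=> [_ _ fE].
have lnvK x : pos_orthant R n x -> expv (lnv x) = x.
  by move=> x0; apply/rowP => k; rewrite !mxE lnK// posrE.
have expvK : cancel (@expv R n) (@lnv R n).
  by move=> y; apply/rowP => k; rewrite !mxE expRK.
have expv_gt0 y : pos_orthant R n (expv y) by move=> k; rewrite mxE expR_gt0.
have fE' x : pos_orthant R n x -> f x = expsum c a (lnv x).
  by move=> x0; rewrite fE//; apply: eq_bigr => i _; rewrite monomialE.
split.
- apply: continuous_in_subspaceT => x /set_mem[x0 _].
  apply: mx_continuous_at => i j; rewrite ord1.
  rewrite (_ : (fun t => _) = @ln R \o (fun t : 'rV[R]_n => t 0 j)); last first.
    by apply/funext => t /=; rewrite mxE.
  apply: continuous_comp; first exact: coord_continuous.
  exact: continuous_ln.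
- apply: continuous_subspaceT => y; apply: mx_continuous_at => i j; rewrite ord1.
  rewrite (_ : (fun t => _) = @expR R \o (fun t : 'rV[R]_n => t 0 j)); last first.
    by apply/funext => t /=; rewrite mxE.
  apply: continuous_comp; first exact: coord_continuous.
  exact: continuous_expR.
- by move=> x [x0 fx0]; rewrite /expsum_zeros/= -fE'.
- by move=> y y0; split => //; rewrite fE'// expvK.
- by split => [x /set_mem[x0 _]|y _]; [exact: lnvK|exact: expvK].
Qed.

(** * Linear changes of coordinates and affinely spanning exponents *)

Lemma mulmxr_continuous (R : realType) n p (M : 'M[R]_(n, p)) :
  continuous (fun y : 'rV[R]_n => y *m M).
Proof.
move=> y; apply: mx_continuous_at => i j.
rewrite (_ : (fun t => _) = dot (col j M)^T); first exact: dot_continuous.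
apply/funext => t; rewrite dotE mxE; apply: eq_bigr => k _.
by rewrite !mxE ord1 mulrC.
Qed.

(** Since <a M, y> = <a, y M^T>, transforming the exponents by [M] amounts to transforming the
    variable by the inverse transpose. *)
Lemma expsum_linear_change (R : realType) n k (c : 'I_k -> R)
    (a : 'I_k -> 'rV[R]_n) (M : 'M[R]_n) : M \in unitmx ->
  inverse_homeos (expsum_zeros c a) (expsum_zeros c (fun i => a i *m M))
    (mulmxr (invmx M)^T) (mulmxr M^T).
Proof.
move=> uM; have E y : expsum c (fun i => a i *m M) y = expsum c a (y *m M^T).
  by apply: eq_bigr => i _; rewrite /dot trmx_mul trmxK mulmxA.
split.
- by apply: continuous_subspaceT; exact: mulmxr_continuous.
- by apply: continuous_subspaceT; exact: mulmxr_continuous.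
- move=> y/=; rewrite /expsum_zeros/= E => <-; congr expsum.
  by rewrite -mulmxA -trmx_mul mulmxV// trmx1 mulmx1.
- by move=> y/=; rewrite /expsum_zeros/= E.
- split=> y _ /=.
    by rewrite -mulmxA -trmx_mul mulmxV// trmx1 mulmx1.
  by rewrite -mulmxA -trmx_mul mulVmx// trmx1 mulmx1.
Qed.

(* The affine span condition, by duality: no nonzero linear form is constant on
   the exponents. *)
Definition affinely_spanning (R : realType) n k (a : 'I_k -> 'rV[R]_n) :=
  forall u : 'rV[R]_n, (forall i j, dot (a i) u = dot (a j) u) -> u = 0.

Lemma dot_self_eq0 (R : realType) n (u : 'rV[R]_n) : dot u u = 0 -> u = 0.
Proof.
rewrite dotE => /eqP; rewrite psumr_eq0 => [/allP u0|j _]; last by rewrite -expr2 sqr_ge0.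
apply/rowP => j; rewrite mxE; apply/eqP.
by have := u0 j (mem_index_enum _); rewrite mulf_eq0 orbb.
Qed.

(** If the form <., u> is constant on the exponents, its level set there is convex and is a
    translate of the kernel, so it contains [Newt a] and then its affine span, the whole space.
    Evaluating at u and at 0 gives <u, u> = 0. *)
Lemma has_dim_affinely_spanning (R : realType) n k (a : 'I_k -> 'rV[R]_n)
    (i0 : 'I_k) : has_dim (Newt a) n -> affinely_spanning a.
Proof.
move=> [x [U [aU dimU]]] u uP.
have Uf : U = fullv.
  by apply/eqP; rewrite eqEdim subvf dimU dimvf/= dim_matrix [(1%N * n)%R]mul1n.
pose f : {linear 'rV[R]_n -> 'rV[R]_1} := mulmxr u^T.
have ker v : v \in lker (linfun f) = (dot v u == 0).
  rewrite memv_ker lfunE/=; apply/eqP/eqP => [|v0].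
    by rewrite /dot => ->; rewrite mxE.
  by apply/rowP => j; rewrite ord1 [RHS]mxE -[LHS]/(dot v u).
have H : affine_span (Newt a) `<=` [set v | dot v u = dot (a i0) u].
  apply: smallest_sub.
    exists (a i0), (lker (linfun f)); apply/seteqP; split => [v/= vu|_ [w/= wk <-]]/=.
      exists (v - a i0); last by rewrite addrC subrK.
      by rewrite /= ker dotBl vu subrr.
    by rewrite dotDl; move: wk; rewrite ker => /eqP ->; rewrite addr0.
  apply: smallest_sub; last by move=> _ [i _ <-]/=; exact: uP.
  move=> v w l; rewrite !inE/= => vu wu.
  rewrite /conv/= dotDl.
  have dotZl r z : dot (r *: z) u = r * dot z u by rewrite /dot -scalemxAl mxE.
  by rewrite !dotZl vu wu -mulrDl unstable.add_onemK mul1r.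
have {}H v : dot v u = dot (a i0) u.
  apply: (H v); rewrite aU Uf; exists (v - x); first exact: memvf.
  by rewrite addrC subrK.
by apply: dot_self_eq0; rewrite H -(H 0) /dot mul0mx mxE.
Qed.

(** Duality says that the matrix of differences [a i - a i0] has full column rank. Its rows selected
    by [s] form an invertible matrix, and [M] is the inverse. *)
Lemma affinely_spanning_basis (R : realType) n k (a : 'I_k -> 'rV[R]_n) (i0 : 'I_k) :
  affinely_spanning a -> exists (s : 'I_n -> 'I_k) (M : 'M[R]_n),
    M \in unitmx /\ forall j, (a (s j) - a i0) *m M = 'e_j.
Proof.
move=> nd; pose A := \matrix_(i < k) (a i - a i0).
have fA : row_full A.
  rewrite /row_full -mxrank_tr; apply: inj_row_free => v vA; apply: nd => i j.
  have ai l : dot (a l) v = dot (a i0) v.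
    apply/eqP; rewrite -subr_eq0 -dotBl -(rowK (fun i => a i - a i0) l) -/A.
    by rewrite /dot -row_mul -[A]trmxK -trmx_mul vA linear0 !mxE.
  by rewrite !ai.
exists (fullrankfun fA), (invmx (rowsub (fullrankfun fA) A)).
have uB := fullrowsub_unit fA; split=> [|j]; first by rewrite unitmx_inv.
rewrite -[a _ - _](rowK (fun i => a i - a i0)) -/A -row_rowsub -row_mul mulmxV//.
exact: row1.
Qed.

(** The base index [i0] and the indices [s j] are n + 1 distinct indices. In the induction this
    keeps the second argument of [P_comp] positive. *)
Lemma affinely_spanning_lt (R : realType) n k (a : 'I_k -> 'rV[R]_n) :
  (0 < k)%N -> affinely_spanning a -> (n < k)%N.
Proof.
move=> k0 nd; pose i0 := Ordinal k0.
have [s [M [uM sM]]] := affinely_spanning_basis i0 nd.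
(* The n + 1 indices are parametrised by [option 'I_n], with [None] sent to [i0]. *)
suff : injective (oapp s i0) by move/leq_card; rewrite card_option !card_ord.
have e0 j : 'e_j <> 0 :> 'rV[R]_n.
  by move/rowP/(_ j); rewrite !mxE !eqxx => /eqP; rewrite oner_eq0.
have si j : s j <> i0 by move=> sj; apply: (e0 j); rewrite -sM sj subrr mul0mx.
move=> [j|] [l|]//=; last 2 first.
- by move/si.
- by move/esym/si.
move=> sjl; congr Some; have := sM j; rewrite sjl sM => /rowP/(_ j).
rewrite !mxE !eqxx/= eq_sym; case: eqP => // _ /eqP.
by rewrite eq_sym oner_eq0.
Qed.

Lemma affinely_spanning_mulmxr (R : realType) n k (a : 'I_k -> 'rV[R]_n) M :
  M \in unitmx -> affinely_spanning a -> affinely_spanning (fun i => a i *m M).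
Proof.
move=> uM nd u h; have uM0 : u *m M^T = 0.
  by apply: nd => i j; have := h i j; rewrite /dot trmx_mul trmxK !mulmxA.
by rewrite -[u]mulmx1 -trmx1 -(mulVmx uM) trmx_mul mulmxA uM0 mul0mx.
Qed.

(** * Slices by coordinate hyperplanes *)

(** The term of largest frequency dominates: once its exponential is factored out, the sum tends to
    the coefficient of that term. Injectivity of [l] makes the maximum strict. *)
Lemma expsum1_neq0 (R : realType) (I : finType) (P : pred I) (c l : I -> R) i0 :
  P i0 -> (forall i, P i -> c i != 0) -> {in P &, injective l} ->
  \forall t \near +oo, \sum_(i | P i) c i * expR (l i * t) != 0.
Proof.
move=> Pi0 c0 linj.
have [i Pi imax] := arg_maxP l Pi0.
pose g t := \sum_(j | P j) c j * expR ((l j - l i) * t).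
suff gc : g t @[t --> +oo] --> c i.
  near=> t; rewrite (_ : \sum_(_ | _) _ = expR (l i * t) * g t); last first.
    rewrite mulr_sumr; apply: eq_bigr => j _.
    by rewrite mulrCA -expRD -mulrDl addrC subrK.
  rewrite mulf_neq0//; first by rewrite gt_eqF// expR_gt0.
  by near: t; apply: cvgr_neq0 gc _; exact: c0.
(* The limit is written as a sum so that convergence can be checked term by term. *)
rewrite (_ : c i = \sum_(j | P j) (if j == i then c i else 0)); last first.
  rewrite -big_mkcondr (big_pred1 i)// => j /=.
  by case: eqP => [->|]; rewrite ?andbT ?andbF.
apply: (@cvg_big _ _ +%R).
  by move=> /= x; exact: add_continuous.
move=> j Pj; case: eqP => [->|/eqP ji].
  under eq_cvg do rewrite subrr mul0r expR0 mulr1; exact: cvg_cst.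
rewrite -[0](mulr0 (c j)); apply: cvgMr.
have lji : 0 < l i - l j.
  have lji : l j <= l i := imax j Pj.
  rewrite subr_gt0 lt_neqAle lji andbT; apply: contra ji => /eqP ?.
  by apply/eqP/linj.
under eq_cvg do rewrite -opprB mulNr.
apply: (@cvg_comp _ _ _ (fun t => (l i - l j) * t) (fun t => expR (- t)) _ +oo).
  by apply: gt0_cvgMry => //; exact: cvg_id.
exact: cvgr_expR.
Unshelve. all: by end_near. Qed.

(** The parametrisation of the hyperplane y_p = t, a section of the projection [col' p]. *)
Definition insert_coord (R : realType) n (p : 'I_n.+1) (t : R) (y : 'rV[R]_n) :
  'rV[R]_n.+1 := \row_j oapp (y 0) t (unlift p j).

Lemma insert_coord_p (R : realType) n (p : 'I_n.+1) (t : R) (y : 'rV[R]_n) :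
  insert_coord p t y 0 p = t.
Proof. by rewrite mxE unlift_none. Qed.

Lemma insert_coord_col' (R : realType) n (p : 'I_n.+1) (y : 'rV[R]_n.+1) :
  insert_coord p (y 0 p) (col' p y) = y.
Proof. by apply/rowP => j; rewrite mxE; case: unliftP => [i|] ->//=; rewrite mxE. Qed.

Lemma dot_insert_coord (R : realType) n (p : 'I_n.+1) (t : R) (y : 'rV[R]_n) b :
  dot b (insert_coord p t y) = b 0 p * t + dot (col' p b) y.
Proof.
rewrite !dotE (bigD1_ord p)//= insert_coord_p; congr +%R.
by apply: eq_bigr => j _; rewrite !mxE liftK.
Qed.

Lemma insert_coord_continuous (R : realType) n (p : 'I_n.+1) (t : R) :
  continuous (@insert_coord R n p t).
Proof.
move=> y; apply: mx_continuous_at => i j; rewrite ord1.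
rewrite (_ : (fun t => _) = fun y : 'rV[R]_n => oapp (y 0) t (unlift p j)); last first.
  by apply/funext => z; rewrite mxE.
by case: (unlift p j) => [l|]; [exact: coord_continuous|exact: cst_continuous].
Qed.

(** On y_p = t, terms with the same projected exponent merge, and their coefficients, weighted by
    exp(b_p t), add up. The first hypothesis says that no merged coefficient cancels; the pair [i1],
    [i2] accounts for the lost term. *)
Lemma expsum_slice (R : realType) n k (c : 'I_k -> R) (b : 'I_k -> 'rV[R]_n.+1)
    (p : 'I_n.+1) (t : R) i1 i2 :
  (forall i, \sum_(j | col' p (b j) == col' p (b i)) c j * expR (b j 0 p * t) != 0) ->
  i1 != i2 -> col' p (b i1) = col' p (b i2) -> affinely_spanning b ->
  exists k' (c' : 'I_k' -> R) (b' : 'I_k' -> 'rV[R]_n),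
    [/\ (1 <= k' <= k - 1)%N, forall i, c' i != 0, injective b', affinely_spanning b' &
      forall y, expsum c b (insert_coord p t y) = expsum c' b' y].
Proof.
move=> cn0 i12 b12 nd.
(* The list [s] holds the distinct projected exponents; [q] below sends each term to its group. *)
pose s0 := [seq col' p (b i) | i <- enum 'I_k]; pose s := undup s0.
have bs i : col' p (b i) \in s.
  by rewrite mem_undup; apply/mapP; exists i => //; rewrite mem_enum.
have bi i : (index (col' p (b i)) s < size s)%N by rewrite index_mem.
pose q i := Ordinal (bi i).
pose b' := tnth (in_tuple s).
have b'q i : b' (q i) = col' p (b i) by rewrite /b' (tnth_nth 0)/= nth_index.
have b'inj : injective b' by apply/tuple_uniqP; exact: undup_uniq.
have qi i j : (q i == j) = (col' p (b i) == b' j) by rewrite -b'q (inj_eq b'inj).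
have qsurj j : exists i, q i = j.
  have : b' j \in s0 by rewrite -mem_undup mem_tnth.
  by move=> /mapP[i _ bij]; exists i; apply/eqP; rewrite qi bij.
exists (size s), (fun j => \sum_(i | q i == j) c i * expR (b i 0 p * t)), b'.
split => //.
- apply/andP; split; first exact: leq_ltn_trans (bi i1).
  rewrite -ltnS subn1 prednK; last exact: leq_ltn_trans (ltn_ord i1).
  rewrite -[X in (_ < X)%N]card_ord cardE -(size_map (fun i => col' p (b i))).
  (* Strictness holds because [i1] and [i2] give a repeated entry. *)
  rewrite ltn_size_undup.
  by apply/negP => /(@injectiveP _ _ (fun i => col' p (b i)))/(_ _ _ b12)/eqP; exact/negP.
- move=> j; have [i <-] := qsurj j; have := cn0 i.
  by under eq_bigl do rewrite -!b'q (inj_eq b'inj).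
(* A form constant on the projected exponents, extended by a zero coordinate at [p], is constant on
   the exponents [b]. *)
- move=> u uP; have u0 : insert_coord p 0 u = 0.
    by apply: nd => i j; rewrite !dot_insert_coord !mulr0 !add0r -!b'q; exact: uP.
  by apply/rowP => j; have /rowP/(_ (lift p j)) := u0; rewrite !mxE liftK.
- move=> y; rewrite /expsum (partition_big q xpredT)//=; apply: eq_bigr => j _.
  rewrite mulr_suml; apply: eq_bigr => i /eqP <-.
  by rewrite b'q dot_insert_coord expRD mulrA.
Qed.

(** * Non-compact components and the facets of a cube *)

Lemma noncompact_unbounded (R : realType) n (C : set 'rV[R]_n) (T : R) :
  closed C -> ~ compact C -> exists2 q, C q & T < `|q|.
Proof.
move=> Ccl Cnc; apply: contrapT => noq; apply: Cnc.
apply: bounded_closed_compact => //; exists T; split; first exact: num_real.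
move=> M TM q Cq; apply: le_trans (ltW TM).
by rewrite leNgt; apply/negP => Tq; apply: noq; exists q.
Qed.

Lemma connected_norm_eq (R : realType) n (C : set 'rV[R]_n) q1 q2 (T : R) :
  connected C -> C q1 -> C q2 -> `|q1| <= T <= `|q2| -> exists2 r, C r & `|r| = T.
Proof.
move=> Cc C1 C2 T12.
have : connected [set `|r| | r in C].
  by apply: connected_continuous_connected => //;
    apply: continuous_subspaceT; exact: norm_continuous.
move/connected_intervalP => /(_ `|q1| `|q2|).
case/(_ _ _ _ T12); [by exists q1|by exists q2|].
by move=> r Cr <-; exists r.
Qed.

(** The norm is the sup norm, so it is attained at some coordinate; the index and the sign bit
    together name a facet of the cube. *)
Lemma norm_coord (R : realType) n (r : 'rV[R]_n) (T : R) : 0 < T -> `|r| = T ->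
  exists p : 'I_n * bool, r 0 p.1 = (-1) ^+ p.2 * T.
Proof.
move=> T0 rT; have /mx_norm_neq0[[i j]/= rij] : mx_norm r != 0.
  by rewrite -[mx_norm r]/(`|r|) rT gt_eqF.
exists (j, r 0 j < 0) => /=; have -> : T = `|r 0 j|.
  by rewrite -rT -[LHS]/(mx_norm r) rij ord1.
by apply: realEsign; exact: num_real.
Qed.

(** Each component in [D] is assigned a facet that it meets, then the slice component of the meeting
    point. On one facet this is injective: a slice component embeds as a connected subset of [W], so
    it lies in a single component of [W]. *)
Lemma le_counting_facets (R : realType) n (W : set 'rV[R]_n.+1) (T : R) (B : \bar R)
    (D : {fset set 'rV[R]_n.+1}) :
  0 < T -> [set` D] `<=` components W ->
  (forall C, C \in D -> exists2 r, C r & `|r| = T) ->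
  (forall p : 'I_n.+1 * bool,
     Tot [set y | W (insert_coord p.1 ((-1) ^+ p.2 * T) y)] <= B)%E ->
  ((#|` D|)%:R%:E <= (2 * n.+1)%:R%:E * B)%E.
Proof.
move=> T0 DW Dr slice_le.
(* Sets outside [D] get a dummy point and facet, since [choice] asks for a total function. *)
have /choice[q qP] : forall C : set 'rV[R]_n.+1,
    exists q : 'rV[R]_n.+1 * ('I_n.+1 * bool),
    C \in D -> C q.1 /\ q.1 0 q.2.1 = (-1) ^+ q.2.2 * T.
  move=> C; have [CD|nCD] := boolP (C \in D); last by exists (0, (ord0, false)).
  have [r Cr rT] := Dr _ CD; have [p rp] := norm_coord T0 rT.
  by exists (r, p).
rewrite (card_fset_fibers (fun C => (q C).2)) natr_sum -sumEFin.
apply: (@le_trans _ _ (\sum_(p : 'I_n.+1 * bool) B)%E); last first.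
  rewrite (eq_bigr (fun=> 1%:E * B)%E); last by move=> *; rewrite mul1e.
  rewrite -ge0_sume_distrl// sumEFin sumr_const card_prod card_ord card_bool.
  by rewrite mulnC.
apply: lee_sum => p _; apply: le_trans (slice_le p); rewrite -counting_fset.
pose Y := [set y | W (insert_coord p.1 ((-1) ^+ p.2 * T) y)].
rewrite -[Tot _]/(Tot Y).
pose g C := connected_component Y (col' p.1 (q C).1).
have DpP C : C \in [fset C in D | (q C).2 == p]%fset ->
    [/\ C = connected_component W (q C).1, W (q C).1 &
      insert_coord p.1 ((-1) ^+ p.2 * T) (col' p.1 (q C).1) = (q C).1].
  rewrite !inE/= => /andP[CD /eqP Cp]; have [Cq qT] := qP _ CD.
  have [x Wx CE] := DW _ CD.
  split; last by rewrite -Cp -qT insert_coord_col'.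
    by rewrite -{1}CE; apply: same_connected_component; rewrite CE.
  by move: Cq; rewrite -{1}CE => /connected_component_sub.
apply: (@counting_le_inj _ _ _ g); last first.
  move=> _ [C /DpP[_ Wq insq] <-]; exists (col' p.1 (q C).1) => //.
  by rewrite /Y/= insq.
move=> C1 C2 /set_mem/DpP[C1E Wq1 ins1] /set_mem/DpP[C2E Wq2 ins2] gC12.
rewrite C1E C2E; apply: same_connected_component.
rewrite -{1}ins1 -ins2.
apply: (@image_component_sub _ _ Y W (insert_coord p.1 ((-1) ^+ p.2 * T))) => //.
- by apply: continuous_subspaceT; exact: insert_coord_continuous.
- by rewrite /Y/= ins1.
- exists (col' p.1 (q C2).1) => //; rewrite -[connected_component _ _]/(g C1) gC12.
  by apply: connected_component_refl; rewrite /Y/= ins2.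
Qed.

(** As [D] is finite, one [T] can exceed the norm of a chosen point in every component and also
    prevent cancellation on every facet. Each component, being unbounded and connected, then meets
    the sphere of radius [T], which is the cube boundary. *)
Lemma Non_le_facets (R : realType) n k (c : 'I_k -> R) (b : 'I_k -> 'rV[R]_n.+1)
    (i0 : 'I_k) (s : 'I_n.+1 -> 'I_k) (B : \bar R) :
  (forall i, c i != 0) -> injective b -> affinely_spanning b ->
  (forall p, b (s p) - b i0 = 'e_p) ->
  (forall k' (c' : 'I_k' -> R) (b' : 'I_k' -> 'rV[R]_n),
    (1 <= k' <= k - 1)%N -> (forall i, c' i != 0) -> injective b' ->
    affinely_spanning b' -> (Tot (expsum_zeros c' b') <= B)%E) ->
  (Non (expsum_zeros c b) <= (2 * n.+1)%:R%:E * B)%E.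
Proof.
move=> c0 binj nd bs slice_le; apply: counting_le_fset => D DW.
(* Within a merged group the exponents differ at coordinate [p], so their frequencies along that
   axis are distinct. *)
have col_inj p i : {in [pred j | col' p (b j) == col' p (b i)] &,
    injective (fun j => b j 0 p)}.
  move=> j1 j2; rewrite !inE => /eqP h1 /eqP h2 b12; apply: binj.
  by rewrite -[b j1](insert_coord_col' p) -[b j2](insert_coord_col' p) b12 h1 h2.
have Dpt C : exists q, C \in D -> C q.
  have [/DW[[q Wq <-] _]|nCD] := pselect (C \in D); last by exists 0.
  by exists q => _; exact: connected_component_refl.
have {Dpt}[q qP] := choice Dpt.
have [T [T0 qT cT]] : exists T, [/\ 0 < T, forall C : D, `|q (val C)| <= T &
    forall e : 'I_n.+1 * 'I_k * bool,
    \sum_(j | col' e.1.1 (b j) == col' e.1.1 (b e.1.2))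
       c j * expR (b j 0 e.1.1 * ((-1) ^+ e.2 * T)) != 0].
  near (+oo : set_system R)%R => T; exists T; split; near: T.
  - exact: nbhs_pinfty_gt.
  - by apply: filter_forall => C; exact: nbhs_pinfty_ge.
  - apply: filter_forall => -[[p i] e]/=.
    (* The sign of the facet is absorbed into the frequencies, so both opposite facets become limits
       at [+oo]. *)
    near=> T; under eq_bigr do rewrite mulrA.
    near: T; apply: (@expsum1_neq0 _ _ _ c (fun j => b j 0 p * (-1) ^+ e) i) => //.
    move=> j1 j2 h1 h2 /mulIf h; apply: (col_inj p i) => //; apply: h.
    by rewrite signr_eq0.
apply: (@le_counting_facets _ _ (expsum_zeros c b) T) => //.
- by move=> C /DW[].
- move=> C CD; have [CW Cnc] := DW _ CD; have [x Wx CE] := CW.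
  have Ccl : closed C.
    by rewrite -CE; apply: component_closed; exact: closed_expsum_zeros.
  have [q2 Cq2 Tq2] := noncompact_unbounded T Ccl Cnc.
  apply: (@connected_norm_eq _ _ C (q C) q2) => //.
  + by rewrite -CE; exact: component_connected.
  + exact: qP.
  + by rewrite (qT [` CD]%fset)/= ltW.
- move=> [p e]/=; set t := _ * T.
  have spi : s p != i0.
    apply/eqP => sp; have /rowP/(_ p) := bs p.
    by rewrite sp subrr !mxE !eqxx => /esym/eqP; rewrite oner_eq0.
  (* The exponents of [s p] and [i0] differ by ['e_p] only, hence merge on the facets orthogonal to
     that axis. *)
  have csp : col' p (b (s p)) = col' p (b i0).
    rewrite -[b (s p)](subrK (b i0)) bs; apply/rowP => j.
    by rewrite !mxE [_ == p]eq_sym (negbTE (neq_lift p j)) andbF add0r.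
  have cTt i : \sum_(j | col' p (b j) == col' p (b i)) c j * expR (b j 0 p * t) != 0.
    exact: (cT (p, i, e)).
  have [k' [c' [b' [k'k c'0 b'inj nd' slE]]]] :=
    @expsum_slice _ _ _ c b p t _ _ cTt spi csp nd.
  rewrite (_ : [set y | _] = expsum_zeros c' b'); first exact: slice_le.
  by apply/seteqP; split => y; rewrite /expsum_zeros/= slE.
Unshelve. all: by end_near. Qed.

Lemma Non_expsum_le (R : realType) n k (c : 'I_k -> R) (a : 'I_k -> 'rV[R]_n.+1)
    (B : \bar R) :
  (0 < k)%N -> (forall i, c i != 0) -> injective a -> affinely_spanning a ->
  (forall k' (c' : 'I_k' -> R) (a' : 'I_k' -> 'rV[R]_n),
    (1 <= k' <= k - 1)%N -> (forall i, c' i != 0) -> injective a' ->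
    affinely_spanning a' -> (Tot (expsum_zeros c' a') <= B)%E) ->
  (Non (expsum_zeros c a) <= (2 * n.+1)%:R%:E * B)%E.
Proof.
move=> k0 c0 ainj asp slice_le; pose i0 := Ordinal k0.
have [s [M [uM sM]]] := affinely_spanning_basis i0 asp.
apply: le_trans (homeo_Non (expsum_linear_change c a uM)) _.
apply: (@Non_le_facets _ _ _ _ _ i0 s) => //.
- by move=> i j /(can_inj (mulmxK uM))/ainj.
- exact: affinely_spanning_mulmxr.
- by move=> p; rewrite -mulmxBl.
Qed.

(** * Comparison with the maxima over nomials, and induction on the dimension *)

Lemma Tot_expsum_le_P (R : realType) n k m (c : 'I_k -> R) (a : 'I_k -> 'rV[R]_n) :
  (1 <= k <= m)%N -> (forall i, c i != 0) -> injective a ->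
  (Tot (expsum_zeros c a) <= P R n m)%E.
Proof.
move=> km c0 ainj; pose f x := \sum_i c i * monomial x (a i).
have fP : is_nomial c a f by [].
apply: le_trans (homeo_Tot (inverse_homeosC (nomial_expsum fP))) _.
by apply: ereal_sup_ubound; exists f => //; exists k, c, a.
Qed.

Lemma Comp_expsum_le_P_comp (R : realType) n k m (c : 'I_k -> R)
    (a : 'I_k -> 'rV[R]_n) :
  (1 <= k <= m)%N -> (forall i, c i != 0) -> injective a ->
  (Comp (expsum_zeros c a) <= P_comp R n m)%E.
Proof.
move=> km c0 ainj; pose f x := \sum_i c i * monomial x (a i).
have fP : is_nomial c a f by [].
apply: le_trans (homeo_Comp (inverse_homeosC (nomial_expsum fP))) _.
by apply: ereal_sup_ubound; exists f => //; exists k, c, a.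
Qed.

(** The constant 1 is a 1-nomial, so the supremum is over a nonempty set; for m = 0 it would be
    [-oo]. *)
Lemma P_comp_ge0 (R : realType) n m : (0 < m)%N -> (0 <= P_comp R n m)%E.
Proof.
move=> m0; apply: le_trans (@Comp_expsum_le_P_comp R n 1 m (fun=> 1) (fun=> 0) _ _ _).
- by rewrite /Comp /counting; case: ifPn; rewrite ?lee_fin ?leey.
- by rewrite m0.
- by move=> _; exact: oner_neq0.
- by move=> i j _; rewrite !ord1.
Qed.

(** Compact components give the term i = 0. Non-compact ones are bounded by 2n times the bound for n
    - 1 and m - 1, whose term i becomes the term i + 1. *)
Lemma Tot_expsum_le (R : realType) n m k (c : 'I_k -> R) (a : 'I_k -> 'rV[R]_n) :
  (1 <= k <= m)%N -> (forall i, c i != 0) -> injective a -> affinely_spanning a ->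
  (Tot (expsum_zeros c a) <=
     \sum_(0 <= i < n)
        (2 ^+ i * (n`!%:R / (n - i)`!%:R))%:E * P_comp R (n - i) (m - i))%E.
Proof.
elim: n m k c a => [|n IHn] m k c a /andP[k1 km] c0 ainj asp.
  rewrite big_geq//; suff -> : expsum_zeros c a = set0.
    by rewrite /Tot /components image_set0 /counting asboolT// fset_set0.
  (* In dimension 0 all exponents coincide, so injectivity leaves a single term, which never
     vanishes. *)
  rewrite -subset0 => y /eqP; pose i0 := Ordinal k1.
  rewrite /expsum (bigD1 i0)//= big1 => [|i].
    by rewrite addr0 mulf_eq0 (negbTE (c0 _)) gt_eqF// expR_gt0.
  by rewrite (ainj i i0) ?eqxx// !thinmx0.
have nm : (n.+1 < m)%N by apply: leq_trans (affinely_spanning_lt k1 asp) km.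
rewrite big_nat_recl//= expr0 mul1r !subn0 divff ?mul1e; last first.
  by rewrite pnatr_eq0 -lt0n fact_gt0.
apply: le_trans (Tot_le_split _) _; apply: leeD.
  by apply: Comp_expsum_le_P_comp; rewrite ?k1.
pose S := (\sum_(0 <= i < n)
  (2 ^+ i * (n`!%:R / (n - i)`!%:R))%:E * P_comp R (n - i) (m.-1 - i))%E.
apply: (@le_trans _ _ ((2 * n.+1)%:R%:E * S)%E).
  apply: Non_expsum_le => // k' c' a' /andP[k'1 k'k] c'0 a'inj asp'.
  apply: IHn => //; rewrite k'1/= -subn1; apply: leq_trans k'k _.
  exact: leq_sub2r.
(* Distributing the factor over a sum in the extended reals uses that its terms are nonnegative,
   which is checked last. *)
rewrite /S !big_mkord ge0_sume_distrr => [|i _].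
  rewrite le_eqVlt; apply/orP; left; apply/eqP; apply: eq_bigr => i _.
  rewrite muleA -EFinM subSS -subn1 -subnDA add1n.
  congr (_%:E * _)%E.
  by rewrite exprS factS !natrM -!mulrA [X in 2 * X]mulrCA.
apply: mule_ge0; first by rewrite lee_fin mulr_ge0// ?divr_ge0// exprn_ge0.
apply: P_comp_ge0; rewrite subn_gt0; apply: leq_trans (ltn_ord i) _.
by rewrite -ltnS prednK ?(leq_trans _ nm)// ltnW.
Qed.


Theorem theorem3 (R : realType) (n m : nat) (hn : (2 <= n)%N) (hm : (2 <= m)%N)
    (c : 'I_m -> R) (a : 'I_m -> 'rV[R]_n) (f : 'rV[R]_n -> R)
    (hf : is_nomial c a f) (hdim : has_dim (Newt a) n) :
  let Z := zero_set f in
  (Non Z <= (2 * n)%:R%:E * P R (n - 1) (m - 1))%E /\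
  (Tot Z <=
     \sum_(0 <= i < n)
        (2 ^+ i * (n`!%:R / (n - i)`!%:R))%:E * P_comp R (n - i) (m - i))%E.
Proof.
have m0 : (0 < m)%N by exact: ltnW.
have [c0 ainj _] := hf.
have asp := has_dim_affinely_spanning (Ordinal m0) hdim.
split.
  apply: le_trans (homeo_Non (nomial_expsum hf)) _.
  case: n hn a f hf hdim ainj asp => // n _ a f _ _ ainj asp.
  rewrite (subn1 n.+1); apply: Non_expsum_le => // k' c' a' k'm c'0 a'inj _.
  exact: Tot_expsum_le_P.
apply: le_trans (homeo_Tot (nomial_expsum hf)) _.
by apply: Tot_expsum_le => //; rewrite m0/=.
Qed.
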